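(* In the multi-unit auction with unit demand (with $m$ units, $n$ bidders, $1\le m\le n-1$, types in $[L,U]$), if a feasible anonymous linear Groves mechanism is undominated, then it is an OEL mechanism.
   Context: Multi-unit auction with unit demand: $m$ identical units, $n\ge 2$ bidders, $1\le m\le n-1$, each bidder wants at most one unit; bidder $i$'s type $\theta_i\in[L,U]$ ($L<U$) is her value for one unit. Efficient decisions allocate units to $m$ highest bidders. Groves mechanisms: $t_i(\theta)=\sum_{j\ne i}v_j(f(\theta),\theta_j)+h_i(\theta_{-i})$; player $i$'s utility is value plus $t_i$. The VCG (Clarke) mechanism uses $h_i(\theta_{-i})=-\max_d\sum_{j\ne i}v_j(d,\theta_j)$; here $\sum_i t_i^{VCG}(\theta)=-m[\theta]_{m+1}$, where $[x]_j$ denotes the $j$th highest entry of a vector $x$. An anonymous linear Groves mechanism has $t_i(\theta)=t_i^{VCG}(\theta)+a_0+\sum_{j=1}^{n-1}a_j[\theta_{-i}]_j$ for constants $a_0,\dots,a_{n-1}$. Feasible: $\sum_i t_i(\theta)\le 0$ for all $\theta$. A feasible Groves mechanism $t$ is undominated if no other feasible Groves mechanism $t'$ dominates it, i.e. there is no $t'$ with $t_i(\theta)\le t'_i(\theta)$ for all $\theta,i$ and strict inequality for some $\theta,i$. OEL mechanisms: $t_i(\theta)=t_i^{VCG}(\theta)+c_0+\sum_{j=1}^{n-1}c_j[\theta_{-i}]_j$, where for an index $k\in\{0,\dots,n\}$ with $k-m$ odd the constants are: writing $\alpha_i=(-1)^{m-i}\binom{n-i-1}{n-m-1}/\binom{m-1}{i-1}$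 and $\beta_i=(-1)^{m-i-1}\binom{i-1}{m-1}/\binom{n-m-1}{n-i-1}$, • $k=0$: $c_i=\alpha_i$ for $i=1,\dots,m$; $c_0=Um/n-U\sum_{i=1}^m\alpha_i$; other $c_i=0$. • $1\le k\le m$: $c_i=\alpha_i$ for $i=k+1,\dots,m$; $c_k=m/n-\sum_{i=k+1}^m\alpha_i$; other $c_i=0$ (including $c_0$). • $m+1\le k\le n-1$: $c_i=\beta_i$ for $i=m+1,\dots,k-1$; $c_k=m/n-\sum_{i=m+1}^{k-1}\beta_i$; other $c_i=0$. • $k=n$: $c_i=\beta_i$ for $i=m+1,\dots,n-1$; $c_0=Lm/n-L\sum_{i=m+1}^{n-1}\beta_i$; other $c_i=0$. *)

(* Defs.v *)
From HB Require Import structures.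
From mathcomp Require Import all_boot all_order all_algebra.
Set Implicit Arguments. Unset Strict Implicit. Unset Printing Implicit Defensive.
Import Order.TTheory GRing.Theory Num.Theory.
Local Open Scope ring_scope.

Section Auction.
Variables (R : realFieldType) (n m : nat) (L U : R).

Definition inbox (theta : 'I_n -> R) : Prop := forall j, L <= theta j <= U.

(* [x]_j : j-th highest entry of x (1-indexed) *)
Definition ostat (x : seq R) (j : nat) : R := nth 0 (sort >=%R x) j.-1.

Definition others (theta : 'I_n -> R) (i : 'I_n) : seq R :=
  map theta (filter (predC1 i) (enum 'I_n)).

(* efficient decision f(theta): the m highest bidders win a unit
   (ties broken in favour of lower index) *)
Definition winner (theta : 'I_n -> R) (j : 'I_n) : bool :=
  (count (fun k : 'I_n => ((theta j < theta k)%R || ((theta k == theta j) && (k < j)%N)))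
     (enum 'I_n) < m)%N.

Definition val (theta : 'I_n -> R) (j : 'I_n) : R := if winner theta j then theta j else 0.

Definition welfare_others (theta : 'I_n -> R) (i : 'I_n) : R :=
  \sum_(j < n | j != i) val theta j.

(* VCG: h_i = - max_d sum_{j<>i} v_j(d,theta_j) = - (sum of the m highest of theta_{-i}) *)
Definition tVCG (theta : 'I_n -> R) (i : 'I_n) : R :=
  welfare_others theta i - \sum_(1 <= j < m.+1) ostat (others theta i) j.

(* a mechanism: transfers t i theta *)
Definition mechanism := 'I_n -> ('I_n -> R) -> R.

Definition is_groves (t : mechanism) : Prop :=
  exists h : 'I_n -> ('I_n -> R) -> R,
    (forall i theta theta', inbox theta -> inbox theta' ->
        (forall j, j != i -> theta j = theta' j) -> h i theta = h i theta') /\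
    (forall i theta, inbox theta -> t i theta = welfare_others theta i + h i theta).

Definition feasible (t : mechanism) : Prop :=
  forall theta, inbox theta -> \sum_(i < n) t i theta <= 0.

Definition dominates (t' t : mechanism) : Prop :=
  (forall i theta, inbox theta -> t i theta <= t' i theta) /\
  (exists i theta, inbox theta /\ t i theta < t' i theta).

Definition undominated (t : mechanism) : Prop :=
  ~ exists t' : mechanism, is_groves t' /\ feasible t' /\ dominates t' t.

Definition anon_lin (a : nat -> R) : mechanism := fun i theta =>
  tVCG theta i + a 0%N + \sum_(1 <= j < n) a j * ostat (others theta i) j.

Definition alpha (i : nat) : R :=
  (-1) ^+ (m - i) * ('C(n - i - 1, n - m - 1))%:R / ('C(m - 1, i - 1))%:R.

(* (-1)^(m-i-1) written as (-1)^(i-m-1), same parity, for i >= m+1 *)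
Definition beta (i : nat) : R :=
  (-1) ^+ (i - m - 1) * ('C(i - 1, m - 1))%:R / ('C(n - m - 1, n - i - 1))%:R.

Definition oel_coef (k j : nat) : R :=
  if k == 0%N then
    (if j == 0%N then U * m%:R / n%:R - U * \sum_(1 <= i < m.+1) alpha i
     else if (j <= m)%N then alpha j else 0)
  else if (k <= m)%N then
    (if j == k then m%:R / n%:R - \sum_(k.+1 <= i < m.+1) alpha i
     else if (k < j <= m)%N then alpha j else 0)
  else if (k < n)%N then
    (if j == k then m%:R / n%:R - \sum_(m.+1 <= i < k) beta i
     else if (m < j < k)%N then beta j else 0)
  else
    (if j == 0%N then L * m%:R / n%:R - L * \sum_(m.+1 <= i < n) beta i
     else if (m < j < n)%N then beta j else 0).

Definition is_OEL (t : mechanism) : Prop :=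
  exists k : nat, (k <= n)%N /\ odd (k + m) /\
    forall i theta, inbox theta -> t i theta = anon_lin (oel_coef k) i theta.

End Auction.

(* Main.v *)
Require Import Defs.
From HB Require Import structures.
From mathcomp Require Import all_boot all_order all_algebra.
From mathcomp Require Import ring lra zify.
Import Order.TTheory GRing.Theory Num.Theory.
Local Open Scope ring_scope.
Set Implicit Arguments. Unset Strict Implicit. Unset Printing Implicit Defensive.

(** On ordered type profiles the total transfer of an anonymous linear Groves
mechanism is affine, hence an average of its values [s_k <= 0] at the vertices
(k bidders at U, n - k at L), weighted by the gaps of the profile. If two of
the [s_k] were negative, fix all bidders but one on an equally spaced grid: the
last bidder's type splits only one gap, so the surplus stays bounded away from
zero and she can be paid a bonus on that single profile of the others,
contradicting undominatedness. So at most one [s_k] is nonzero. The alternating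
binomial sum of the [s_k] does not depend on the mechanism, which makes that
[s_k] nonzero and fixes the parity of k; the vanishing of the other [s_j] is a
two-term recursion whose solution from below is beta and from above alpha. *)

(** * Ranking the bidders by type, and the order statistics left after deleting one bidder *)

Section Ranking.
Variables (R : realFieldType) (n : nat).
Implicit Types (theta : 'I_n -> R) (i j : 'I_n).

(** Ties are broken by index, as in [winner]; this makes the relation a linear order, so every
    bidder has a definite rank. *)
Definition rank_rel theta : rel 'I_n := fun i j =>
  (theta j < theta i) || ((theta i == theta j) && (i <= j)%N).

Definition ranking theta : seq 'I_n := sort (rank_rel theta) (enum 'I_n).

Definition profile theta : seq R := map theta (ranking theta).

Lemma rank_rel_total theta : total (rank_rel theta).
Proof.
by move=> i j; rewrite /rank_rel; case: ltgtP => //= _; apply: leq_total.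
Qed.

Lemma rank_rel_refl theta : reflexive (rank_rel theta).
Proof. by move=> i; rewrite /rank_rel eqxx leqnn orbT. Qed.

Lemma rank_rel_anti theta : antisymmetric (rank_rel theta).
Proof.
move=> i j; rewrite /rank_rel; case: ltgtP => //= _ le_ij.
by apply/val_inj/eqP; rewrite eqn_leq.
Qed.

Lemma rank_rel_trans theta : transitive (rank_rel theta).
Proof.
move=> j i k; rewrite /rank_rel => /orP[lt1|/andP[/eqP-> le1]].
  by case/orP=> [lt2|/andP[/eqP<- _]]; rewrite ?lt1 // (lt_trans lt2 lt1).
case/orP=> [->//|/andP[-> le2]]; by rewrite (leq_trans le1 le2) orbT.
Qed.

Lemma perm_ranking theta : perm_eq (ranking theta) (enum 'I_n).
Proof. by rewrite perm_sort. Qed.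

Lemma size_ranking theta : size (ranking theta) = n.
Proof. by rewrite size_sort size_enum_ord. Qed.

Lemma uniq_ranking theta : uniq (ranking theta).
Proof. by rewrite sort_uniq enum_uniq. Qed.

Lemma mem_ranking theta i : i \in ranking theta.
Proof. by rewrite mem_sort mem_enum. Qed.

Lemma size_profile theta : size (profile theta) = n.
Proof. by rewrite size_map size_ranking. Qed.

Lemma ranking_sorted theta : sorted (rank_rel theta) (ranking theta).
Proof. exact: sort_sorted (@rank_rel_total theta) _. Qed.

Lemma map_rank_sorted theta (s : seq 'I_n) :
  sorted (rank_rel theta) s -> sorted >=%R (map theta s).
Proof.
apply: homo_sorted => i j; rewrite /rank_rel => /orP[/ltW//|/andP[/eqP-> _]].
exact: lexx.
Qed.

Lemma sort_ge_eq (s1 s2 : seq R) :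
  sorted >=%R s1 -> perm_eq s1 s2 -> sort >=%R s2 = s1.
Proof.
move=> s1_sorted eq12; apply: (@sorted_eq _ >=%R) => //.
- exact: ge_trans.
- by move=> x y; rewrite andbC => /le_anti.
- exact/sort_sorted/ge_total.
- by rewrite perm_sort perm_sym.
Qed.

Lemma profile_sorted theta : sorted >=%R (profile theta).
Proof. exact/map_rank_sorted/ranking_sorted. Qed.

(** Deleting [i] from the ranking moves only the entries behind her, by one place. Ranks count from
    0, [ostat] from 1. *)
Lemma ostat_others theta i (j : nat) :
  ostat (others theta i) j.+1 =
  nth 0 (profile theta) (if (j < index i (ranking theta))%N then j else j.+1).
Proof.
set s := ranking theta.
have -> : ostat (others theta i) j.+1 = nth 0 (map theta (rem i s)) j.
  rewrite /ostat /= (@sort_ge_eq (map theta (rem i s))) //.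
    apply: map_rank_sorted; rewrite rem_filter ?uniq_ranking //.
    exact: sorted_filter (@rank_rel_trans theta) _ _ (ranking_sorted theta).
  rewrite rem_filter ?uniq_ranking //; apply/perm_map/perm_filter.
  exact: perm_ranking.
have lt_is : (index i s < size s)%N by rewrite index_mem mem_ranking.
rewrite remE map_cat nth_cat size_map size_take lt_is.
rewrite map_take map_drop; case: ifP => [lt_ji | /negbT].
  by rewrite nth_take.
by rewrite -leqNgt => le_ij; rewrite nth_drop addSn subnKC.
Qed.

Lemma sum_ranking theta (F : 'I_n -> R) i0 :
  \sum_(i < n) F i = \sum_(r < n) F (nth i0 (ranking theta) r).
Proof.
rewrite -big_enum /= -(perm_big _ (perm_ranking theta)).
by rewrite [LHS](big_nth i0) size_ranking big_mkord.
Qed.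


(** The count in [winner] runs over the bidders strictly ahead of [i] in the ranking, so it is her
    rank. *)
Lemma winnerE theta (m : nat) i :
  winner m theta i = (index i (ranking theta) < m)%N.
Proof.
rewrite /winner; congr (_ < _)%N; set s := ranking theta.
set p := (X in count X _).
have ltE k : p k = (index k s < index i s)%N.
  have rankE : p k = ~~ rank_rel theta i k.
    by rewrite /p /rank_rel eq_sym; case: ltgtP => //= _; rewrite ltnNge.
  rewrite rankE ltnNge; congr (~~ _).
  apply/idP/idP => [rel_ik | le_ik]; last first.
    have:= sorted_leq_nth (@rank_rel_trans theta) (@rank_rel_refl theta) i
      (ranking_sorted theta).
    move/(_ (index i s) (index k s)); rewrite !inE !index_mem !mem_ranking.
    by rewrite !nth_index ?mem_ranking //; apply.
  rewrite leqNgt; apply/negP => lt_ki.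
  have:= sorted_leq_nth (@rank_rel_trans theta) (@rank_rel_refl theta) i
    (ranking_sorted theta).
  move/(_ (index k s) (index i s)); rewrite !inE !index_mem !mem_ranking.
  rewrite !nth_index ?mem_ranking // => /(_ isT isT (ltnW lt_ki)) rel_ki.
  have eq_ik : i = k by apply: (@rank_rel_anti theta); rewrite rel_ik.
  by rewrite eq_ik ltnn in lt_ki.
rewrite -(permP (perm_ranking theta)) -/s (eq_count ltE).
rewrite -[s in count _ s](mkseq_nth i) count_map.
rewrite (@eq_in_count _ _ (fun r => r < 0 + index i s)%N) => [|r]; last first.
  by rewrite mem_iota /= => lt_rs; rewrite index_uniq // uniq_ranking.
by rewrite -size_filter filter_iota_ltn ?size_iota // index_size.
Qed.

Lemma others_eq theta theta' i :
  (forall j, j != i -> theta j = theta' j) -> others theta i = others theta' i.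
Proof.
by move=> eqt; apply/eq_in_map => j; rewrite mem_filter => /andP[/eqt].
Qed.

Lemma nth_profile theta (r : nat) i0 :
  (r < n)%N -> nth 0 (profile theta) r = theta (nth i0 (ranking theta) r).
Proof. by move=> lt_rn; rewrite (nth_map i0) // size_ranking. Qed.

Lemma sum_val theta (m : nat) : (m <= n)%N ->
  \sum_(j < n) Defs.val m theta j = \sum_(r < m) nth 0 (profile theta) r.
Proof.
move=> le_mn; have [n0 | n_gt0] := posnP n.
  move: le_mn; rewrite {1}n0 leqn0 => /eqP->; rewrite big_ord0.
  apply: big1 => -[j lt_jn] _; by exfalso; rewrite n0 in lt_jn.
pose i0 := Ordinal n_gt0.
rewrite (sum_ranking theta _ i0) (big_ord_widen n _ le_mn) [RHS]big_mkcond.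
apply: eq_bigr => r _; rewrite /Defs.val winnerE index_uniq ?size_ranking ?uniq_ranking //.
by rewrite (nth_profile _ i0).
Qed.

Lemma ranking_antitone theta :
  {homo theta : i j / (i <= j)%N >-> j <= i} -> ranking theta = enum 'I_n.
Proof.
move=> anti; apply: (sorted_sort (@rank_rel_trans theta)).
have: sorted leq (map val (enum 'I_n)) by rewrite val_enum_ord iota_sorted.
rewrite sorted_map; apply: sub_sorted => i j /= le_ij.
by rewrite /rank_rel le_ij; case: ltgtP (anti _ _ le_ij).
Qed.

Lemma profile_antitone theta i :
  {homo theta : i j / (i <= j)%N >-> j <= i} -> nth 0 (profile theta) i = theta i.
Proof.
by move=> anti; rewrite (nth_profile _ i) // ranking_antitone // nth_ord_enum.
Qed.

Lemma profile_inbox theta (L U : R) (r : nat) :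
  (r < n)%N -> inbox L U theta -> L <= nth 0 (profile theta) r <= U.
Proof.
move=> lt_rn box; rewrite (nth_profile _ (Ordinal lt_rn)) //; exact: box.
Qed.

Lemma profile_noninc theta (r : nat) :
  (r.+1 < n)%N -> nth 0 (profile theta) r.+1 <= nth 0 (profile theta) r.
Proof.
move=> lt_rn; have:= sorted_leq_nth ge_trans lexx 0 (profile_sorted theta).
by move/(_ r r.+1); rewrite !inE size_profile; apply=> //; apply: ltnW.
Qed.

End Ranking.

(** * The total transfer as an affine function of the ordered types *)

Section Surplus.
Variables (R : realFieldType) (n m : nat).
Implicit Types (theta : 'I_n -> R) (a x : nat -> R).

(* The coefficient of the (p+1)-st highest type in the total transfer. At
   [p = n - 1] the value [a n], which is not part of the mechanism, has weight 0. *)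
Definition coef a (p : nat) : R :=
  (n - p.+1)%:R * a p.+1 + p%:R * a p - m%:R * (p == m)%:R.

Definition surplus a x : R := n%:R * a 0%N + \sum_(p < n) coef a p * x p.

Lemma sum_threshold (A B : R) (j : nat) : (j < n)%N ->
  \sum_(r < n) (if (j < r)%N then A else B) =
  (n - j.+1)%:R * A + j.+1%:R * B.
Proof.
move=> lt_jn; rewrite -(big_mkord xpredT (fun r => if (j < r)%N then A else B)).
rewrite (@big_cat_nat _ _ _ j.+1) //= addrC; congr (_ + _).
  rewrite mulr_natl -sumr_const_nat; apply: eq_big_nat => r /andP[lt_jr _].
  by rewrite lt_jr.
rewrite mulr_natl -[in RHS](subn0 j.+1) -sumr_const_nat.
by apply: eq_big_nat => r /andP[_]; rewrite ltnS leqNgt => /negbTE->.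
Qed.

(** Deleting one of the [n - j.+1] bidders ranked behind position [j] leaves entry [j] in place;
    deleting one of the other [j.+1] bidders lets entry [j.+1] move up. *)
Lemma sum_ostat_others theta (j : nat) : (j.+1 < n)%N ->
  \sum_(i < n) ostat (others theta i) j.+1 =
  (n - j.+1)%:R * nth 0 (profile theta) j + j.+1%:R * nth 0 (profile theta) j.+1.
Proof.
move=> lt_jn; have i0 := Ordinal lt_jn.
rewrite -(@sum_threshold _ _ j) 1?ltnW // (sum_ranking theta _ i0).
apply: eq_bigr => r _; rewrite ostat_others index_uniq ?size_ranking ?uniq_ranking //.
by case: ifP.
Qed.

Lemma sum_tVCG theta : (m < n)%N ->
  \sum_(i < n) tVCG m theta i = - (m%:R * nth 0 (profile theta) m).
Proof.
move=> lt_mn; set x := nth 0 (profile theta); rewrite sumrB.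
(* Each winner's value is counted by the [n - 1] other bidders. *)
have -> : \sum_(i < n) welfare_others m theta i = n.-1%:R * \sum_(r < m) x r.
  rewrite -(sum_val theta (ltnW lt_mn)); set V := \sum_(j < n) Defs.val m theta j.
  rewrite (eq_bigr (fun i => V - Defs.val m theta i)) => [|i _]; last first.
    by rewrite /V [X in X - _](bigD1 i) //= addrAC subrr add0r.
  rewrite sumrB sumr_const card_ord -/V mulr_natl.
  by rewrite -[X in V *+ X](prednK (leq_ltn_trans _ lt_mn)) // mulrSr addrK.
rewrite exchange_big /= big_add1 /= big_mkord.
have -> : \sum_(j < m) \sum_(i < n) ostat (others theta i) j.+1 =
    \sum_(j < m) ((n - j.+1)%:R * x j + j.+1%:R * x j.+1).
  by apply: eq_bigr => j _; rewrite sum_ostat_others // (leq_ltn_trans _ lt_mn).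
(* One more unit adds [(n - 1) x_k] and removes [(n - k - 1) x_k + (k + 1) x_{k+1}]; the remaining
   [k x_k] cancels the previous total. *)
elim: m lt_mn => [|k IHk] lt_kn; first by rewrite !big_ord0 mulr0 mul0r subrr oppr0.
rewrite !big_ord_recr /= mulrDr opprD addrACA IHk 1?ltnW //.
have -> : n.-1 = (n - k.+1 + k)%N by lia.
by rewrite natrD -[k.+1%:R]natr1; ring.
Qed.

Lemma sum_anon_lin a theta : (m < n)%N ->
  \sum_(i < n) anon_lin m a i theta = surplus a (nth 0 (profile theta)).
Proof.
move=> lt_mn; set x := nth 0 (profile theta).
rewrite /anon_lin /surplus 2!big_split /= sum_tVCG // -/x sumr_const card_ord.
rewrite exchange_big /= big_add1 /=.
under eq_big_nat => j /andP[_ lt_jn].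
  rewrite -mulr_sumr sum_ostat_others -?ltn_predRL // -/x mulrDr.
  over.
rewrite big_split /=.
under [in RHS]eq_bigr do rewrite /coef 2!mulrDl.
rewrite 2!big_split /= mulr_natl.
have -> : \sum_(p < n) - (m%:R * (p == m :> nat)%:R) * x p = - (m%:R * x m).
  rewrite (bigD1 (Ordinal lt_mn)) //= eqxx mulr1 big1 ?addr0 ?mulNr // => i.
  by rewrite -val_eqE /= => /negbTE->; rewrite mulr0 oppr0 mul0r.
case: n lt_mn => // n' _ /=.
(* The weight [n - p.+1] vanishes at the last position and [p] at the first; without these terms
   both sums have [n'] terms, one for each of [a 1, ..., a n']. *)
rewrite big_ord_recr [in X in _ = _ + (_ + X + _)]big_ord_recl /=.
rewrite subnn !mul0r addr0 add0r !big_mkord.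
rewrite (eq_bigr (fun j : 'I_n' => (n'.+1 - j.+1)%:R * a j.+1 * x j)); last first.
  by move=> j _; ring.
rewrite [X in _ + (_ + X) = _](eq_bigr (fun j : 'I_n' => j.+1%:R * a j.+1 * x j.+1)).
  by ring.
by move=> j _; ring.
Qed.

End Surplus.

(** * Vertex values, and why at most one of them is nonzero *)

Section Vertices.
Variables (R : realFieldType) (n m : nat) (L U : R).
Implicit Types (theta : 'I_n -> R) (a x : nat -> R).

Definition vertex (k p : nat) : R := if (p < k)%N then U else L.

Definition vertex_surplus a (k : nat) : R := surplus n m a (vertex k).

(** The types are [x 1, ..., x n], with [x 0] and [x n.+1] as padding. When [x] is nonincreasing,
    the gaps divided by [U - L] are the convex weights of this profile over the vertices. *)
Lemma surplus_vertices a x : x 0%N = U -> x n.+1 = L ->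
  (U - L) * surplus n m a (fun p => x p.+1) =
  \sum_(k < n.+1) (x k - x k.+1) * vertex_surplus a k.
Proof.
move=> x0 xn; have tele i j : (i <= j)%N ->
    \sum_(i <= k < j) (x k - x k.+1) = x i - x j.
  move=> le_ij; rewrite -opprB -telescope_sumr // -sumrN.
  by apply: eq_bigr => k _; rewrite opprB.
rewrite /vertex_surplus /surplus; under [RHS]eq_bigr do rewrite mulrDr mulr_sumr.
rewrite big_split /= -mulr_suml mulrDr.
rewrite -(big_mkord xpredT (fun k => x k - x k.+1)) tele // x0 xn; congr (_ + _).
rewrite exchange_big mulr_sumr; apply: eq_bigr => p _ /=.
rewrite (eq_bigr (fun k : 'I_n.+1 => coef n m a p * ((x k - x k.+1) * vertex k p)));
  last by move=> k _; ring.
rewrite -mulr_sumr mulrCA; congr (_ * _).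
rewrite -(big_mkord xpredT (fun k => (x k - x k.+1) * vertex k p)).
(* Vertices up to [p] have [L] at position [p], later ones have [U]; telescoping gives [(U - x p.+1)
   * L + (x p.+1 - L) * U = (U - L) * x p.+1]. *)
rewrite (@big_cat_nat _ _ _ p.+1) //=; last exact: leqW.
rewrite [X in _ = X + _](@eq_big_nat _ _ _ _ _ _ (fun k => (x k - x k.+1) * L)); last first.
  by move=> k /andP[_]; rewrite ltnS leqNgt /vertex => /negbTE->.
rewrite [X in _ = _ + X](@eq_big_nat _ _ _ _ _ _ (fun k => (x k - x k.+1) * U)); last first.
  by move=> k /andP[lt_pk _]; rewrite /vertex lt_pk.
by rewrite -!mulr_suml !tele ?x0 ?xn //; [ring | apply: leqW].
Qed.

Lemma vertex_surplus_le0 a (k : nat) : (m < n)%N -> L <= U ->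
  feasible L U (@anon_lin R n m a) -> vertex_surplus a k <= 0.
Proof.
move=> lt_mn leLU feas; pose theta (i : 'I_n) := vertex k i.
have box : inbox L U theta.
  by move=> i; rewrite /theta /vertex; case: ifP; rewrite lexx leLU.
have anti : {homo theta : i j / (i <= j)%N >-> j <= i}.
  move=> i j le_ij; rewrite /theta /vertex; case: (ltnP j k) => lt_jk.
    by rewrite (leq_ltn_trans le_ij lt_jk).
  by case: ifP.
have:= feas _ box; rewrite sum_anon_lin // /surplus.
rewrite (eq_bigr (fun p : 'I_n => coef n m a p * vertex k p)) // => p _.
by rewrite profile_antitone.
Qed.

Lemma anon_lin_groves a : is_groves m L U (@anon_lin R n m a).
Proof.
exists (fun i theta => a 0%N + \sum_(1 <= j < n) a j * ostat (others theta i) j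
  - \sum_(1 <= j < m.+1) ostat (others theta i) j); split.
  by move=> i theta theta' _ _ /others_eq->.
by move=> i theta _; rewrite /anon_lin /tVCG; ring.
Qed.

(** Pay [i0] an extra [e] exactly when the others report [y]. This bonus depends on the others only,
    so the mechanism stays Groves, and the slack finances it; the gain is strict at [y] itself. *)
Lemma improvable (t : mechanism R n) (i0 : 'I_n) (y : 'I_n -> R) (e : R) :
  is_groves m L U t -> feasible L U t -> inbox L U y -> 0 < e ->
  (forall theta, inbox L U theta -> (forall j, j != i0 -> theta j = y j) ->
     \sum_(i < n) t i theta <= - e) ->
  ~ undominated m L U t.
Proof.
move=> [h [h_indep tE]] feas y_box e_gt0 slack; apply.
pose agrees theta := [forall j, (j != i0) ==> (theta j == y j)].
have agreesP theta : reflect (forall j, j != i0 -> theta j = y j) (agrees theta).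
  apply: (iffP forallP) => eqt j; last by apply/implyP => /eqt->.
  by move=> ne_j; have:= eqt j; rewrite ne_j => /eqP.
pose bonus i theta := if (i == i0) && agrees theta then e else 0.
exists (fun i theta => t i theta + bonus i theta); split; [|split; [|split]].
- exists (fun i theta => h i theta + bonus i theta); split=> [i theta theta' b b' eqt|].
    congr (_ + _); first exact: h_indep.
    rewrite /bonus; case: eqP => //= i_i0; move: eqt; rewrite i_i0 => eqt.
    congr (if _ then _ else _).
    by apply/agreesP/agreesP => eqy j ne_j; rewrite -eqy // eqt.
  by move=> i theta b; rewrite tE // addrA.
- move=> theta b; rewrite big_split /= [X in _ + X](bigD1 i0) //= [X in _ + (_ + X)]big1.
    rewrite addr0 /bonus eqxx /=; case: ifP => [/agreesP eqy|_].
      by have:= slack _ b eqy; lra.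
    by rewrite addr0; apply: feas.
  by move=> i /negbTE ne_i; rewrite /bonus ne_i.
- by move=> i theta _; rewrite lerDl /bonus; case: ifP => // _; apply: ltW.
- exists i0, y; split=> //; rewrite ltrDl /bonus eqxx.
  by have -> : agrees y by apply/agreesP.
Qed.

(* The value inserted at rank [r] of the grid [y] splits a single gap,
   so the two gaps cover at least one full grid step. *)
Lemma gap_insert (x y : nat -> R) (d : R) (r p q : nat) :
  (forall k, y k - y k.+1 = d) -> (r < n)%N ->
  (forall k, (k <= r)%N -> x k = y k) ->
  (forall k, (r < k <= n)%N -> x k.+1 = y k) ->
  (forall k, (k <= n)%N -> x k.+1 <= x k) ->
  (p < q <= n)%N -> d <= (x p - x p.+1) + (x q - x q.+1).
Proof.
move=> step lt_rn lo hi noninc /andP[lt_pq le_qn].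
(* Only the gaps [r] and [r.+1] involve the inserted value [x r.+1]. *)
have full k : (k <= n)%N -> k != r -> k != r.+1 -> x k - x k.+1 = d.
  move=> le_kn ne_kr ne_kr1; case: (ltnP k r) => [lt_kr | le_rk].
    by rewrite !lo // ltnW.
  case: k => [|k] in le_kn ne_kr ne_kr1 le_rk *; first by lia.
  by rewrite !hi ?step //; lia.
have nonneg k : (k <= n)%N -> 0 <= x k - x k.+1 by move=> /noninc; rewrite subr_ge0.
have le_pn : (p <= n)%N by lia.
(* If [p] and [q] are the two pieces of the split step, they add up to exactly [d]; otherwise one of
   them is a full step. *)
have [/andP[/eqP eq_p /eqP eq_q] | ] := boolP ((p == r) && (q == r.+1)).
  rewrite eq_p eq_q addrA subrK lo // hi ?step //; lia.
rewrite negb_and => ne_pq.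
have [eq_pr|ne_pr] := eqVneq p r.
  have q_full : x q - x q.+1 = d by apply: full => //; lia.
  by rewrite q_full lerDr nonneg //; lia.
have [eq_pr|ne_pr1] := eqVneq p r.+1.
  have q_full : x q - x q.+1 = d by apply: full => //; lia.
  by rewrite q_full lerDr nonneg //; lia.
by rewrite full // lerDl nonneg.
Qed.

Lemma vertex_surplus_unique a (p q : nat) : (m < n)%N -> L < U ->
  feasible L U (@anon_lin R n m a) -> undominated m L U (@anon_lin R n m a) ->
  (p < q <= n)%N -> (vertex_surplus a p == 0) || (vertex_surplus a q == 0).
Proof.
move=> lt_mn ltLU feas undom lt_pqn; apply/norP => -[ne_p ne_q].
have n_gt0 : (0 < n)%N by apply: leq_ltn_trans lt_mn.
have nR_gt0 : 0 < n%:R :> R by rewrite ltr0n.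
have s_le0 k := vertex_surplus_le0 k lt_mn (ltW ltLU) feas.
pose mu := Num.min (- vertex_surplus a p) (- vertex_surplus a q).
have mu_gt0 : 0 < mu by rewrite lt_min !oppr_gt0 !lt_neqAle ne_p ne_q !s_le0.
pose i0 : 'I_n := Ordinal n_gt0.
pose d := (U - L) / n%:R.
have d_ge0 : 0 <= d by rewrite divr_ge0 ?ler0n // subr_ge0 ltW.
(* The grid runs from [y 0 = U] to [y n = L]. Bidders [1, ..., n - 1] are fixed at its interior
   points, while the type of bidder [i0 = 0] varies. *)
pose y k : R := U - k%:R * d.
have yn : y n = L by rewrite /y /d mulrCA divff ?gt_eqF // mulr1; lra.
have y_step k : y k - y k.+1 = d by rewrite /y -natr1; ring.
have y_anti i j : (i <= j)%N -> y j <= y i.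
  by move=> le_ij; rewrite /y lerD2l lerN2 ler_wpM2r // ler_nat.
have y_box : inbox L U (fun i : 'I_n => y i).
  move=> i; rewrite -{1}yn y_anti /=; last exact: ltnW.
  by rewrite -[X in _ <= X]subr0 -(mul0r d) (y_anti 0%N).
(* The bonus is [mu / n] because [(U - L) * (mu / n) = d * mu], the loss guaranteed by the gaps [p]
   and [q]. *)
apply: (@improvable _ i0 _ (mu / n%:R) (anon_lin_groves a) feas y_box _ _ undom).
  exact: divr_gt0.
move=> theta box eq_theta; rewrite sum_anon_lin //.
set r := index i0 (ranking theta).
have lt_rn : (r < n)%N by rewrite /r -[X in (_ < X)%N](size_ranking theta) index_mem mem_ranking.
(* Both sides are order statistics of the bidders other than [i0]: once in [theta], once in the grid
   profile, where [i0] has rank 0. *)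
have insert j : (j.+1 < n)%N ->
    nth 0 (profile theta) (if (j < r)%N then j else j.+1) = y j.+1.
  move=> lt_jn; rewrite -ostat_others (others_eq eq_theta) ostat_others.
  rewrite ranking_antitone; last by move=> i j'; apply: y_anti.
  rewrite -[i0](nth_ord_enum i0 i0) index_uniq ?enum_uniq ?size_enum_ord //=.
  by rewrite (@profile_antitone _ _ _ (Ordinal lt_jn)) // => i j'; apply: y_anti.
pose x k := if k is k'.+1 then (if (k' < n)%N then nth 0 (profile theta) k' else L) else U.
have xE : surplus n m a (nth 0 (profile theta)) = surplus n m a (fun p => x p.+1).
  by rewrite /surplus; congr (_ + _); apply: eq_bigr => i _; rewrite /= ltn_ord.
have x_noninc k : (k <= n)%N -> x k.+1 <= x k.
  case: k => [|k] /=; first by rewrite n_gt0; case/andP: (profile_inbox n_gt0 box).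
  move=> lt_kn; rewrite lt_kn; case: ifP => [lt_k1n | _]; first exact: profile_noninc.
  by case/andP: (profile_inbox lt_kn box).
have gap : d <= (x p - x p.+1) + (x q - x q.+1).
  apply: (@gap_insert x y d r) => //.
    case=> [|k] /=; first by rewrite /y mul0r subr0.
    move=> lt_kr; have lt_k1n := leq_ltn_trans lt_kr lt_rn.
    by rewrite ltnW // -insert // lt_kr.
  case=> [|k] //= /andP[]; rewrite ltnS leq_eqVlt => le_rk.
  rewrite leq_eqVlt => /orP[/eqP eq_kn | lt_k1n]; first by rewrite eq_kn ltnn yn.
  by rewrite lt_k1n -insert // ltnNge leq_eqVlt le_rk.
have [lt_pq le_qn] := andP lt_pqn.
have x0 : x 0%N = U by [].
have xn : x n.+1 = L by rewrite /= ltnn.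
clearbody x.
(* All terms of the vertex expansion are nonpositive; keep [p] and [q], each at most [- mu] times
   its gap. *)
have key : (U - L) * surplus n m a (fun p => x p.+1) <= - (d * mu).
  rewrite surplus_vertices //.
  have lt_p : (p < n.+1)%N by lia.
  rewrite (bigD1 (Ordinal lt_p)) // (bigD1 (Ordinal (n := n.+1) (m := q) le_qn)) /=; last first.
    by rewrite -val_eqE /= gtn_eqF.
  set S := \sum_(k < n.+1 | _) _.
  have S_le0 : S <= 0.
    apply: sumr_le0 => k _; rewrite mulr_ge0_le0 // subr_ge0 x_noninc //.
    by rewrite -ltnS.
  have mu_p : vertex_surplus a p <= - mu by rewrite lerNr ge_min lexx.
  have mu_q : vertex_surplus a q <= - mu by rewrite lerNr ge_min lexx orbT.
  have gp : 0 <= x p - x p.+1 by rewrite subr_ge0 x_noninc //; lia.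
  have gq : 0 <= x q - x q.+1 by rewrite subr_ge0 x_noninc.
  have hp := ler_wpM2l gp mu_p; have hq := ler_wpM2l gq mu_q.
  have hd := ler_wpM2r (ltW mu_gt0) gap.
  lra.
rewrite xE -(ler_pM2l (x := U - L)) ?subr_gt0 //; apply: le_trans key _.
by rewrite /d mulrN lerN2 mulrA mulrAC.
Qed.

End Vertices.

(** * Linear relations between the constants [a] and the vertex values *)

Section Coefficients.
Variables (R : realFieldType) (n m : nat) (L U : R).
Hypotheses (m_gt0 : (0 < m)%N) (lt_mn : (m < n)%N).
Implicit Types a : nat -> R.

Lemma vertex_surplusS a (k : nat) : (k < n)%N ->
  vertex_surplus n m L U a k.+1 - vertex_surplus n m L U a k = (U - L) * coef n m a k.
Proof.
move=> lt_kn; rewrite /vertex_surplus /surplus opprD addrACA subrr add0r -sumrB.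
rewrite (bigD1 (Ordinal lt_kn)) //= big1 => [|p].
  by rewrite /vertex ltnSn ltnn; ring.
rewrite -val_eqE /= => ne_pk; rewrite /vertex ltnS.
by rewrite leq_eqVlt (negbTE ne_pk) subrr.
Qed.

(** Each [a j] occurs with weight [n - j] at position [j - 1] and weight [j] at position [j], in
    total [n]. *)
Lemma sum_coef a : \sum_(p < n) coef n m a p = n%:R * \sum_(1 <= j < n) a j - m%:R.
Proof.
rewrite /coef; case: n lt_mn => // n' lt_mn'.
rewrite 2!big_split /= big_ord_recr [X in _ + X + _]big_ord_recl /=.
rewrite subnn !mul0r addr0 add0r; congr (_ + _); last first.
  rewrite (bigD1 (Ordinal lt_mn')) //= eqxx mulr1 big1 ?addr0 // => p.
  by rewrite -val_eqE /= => /negbTE->; rewrite mulr0 oppr0.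
rewrite -big_split /= big_add1 /= big_mkord mulr_sumr; apply: eq_bigr => p _.
rewrite -mulrDl -natrD; congr (_%:R * _); have := ltn_ord p; rewrite /bump /=; lia.
Qed.

Lemma vertex_surplus0 a : vertex_surplus n m L U a 0%N =
  n%:R * a 0%N + L * (n%:R * \sum_(1 <= j < n) a j - m%:R).
Proof.
rewrite /vertex_surplus /surplus -sum_coef mulr_sumr; congr (_ + _).
by apply: eq_bigr => p _; rewrite mulrC.
Qed.

Lemma vertex_surplusn a : vertex_surplus n m L U a n =
  n%:R * a 0%N + U * (n%:R * \sum_(1 <= j < n) a j - m%:R).
Proof.
rewrite /vertex_surplus /surplus -sum_coef mulr_sumr; congr (_ + _).
by apply: eq_bigr => p _; rewrite mulrC /vertex ltn_ord.
Qed.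

(** Since [(n - p.+1) 'C(n.-1, p) = p.+1 'C(n.-1, p.+1)], the two occurrences of each [a j] cancel
    and only the VCG term survives. *)
Lemma alternating_coef a :
  \sum_(p < n) (-1) ^+ p * 'C(n.-1, p)%:R * coef n m a p =
  - ((-1) ^+ m * m%:R * 'C(n.-1, m)%:R).
Proof.
under eq_bigr do rewrite /coef mulrDr.
rewrite big_split /= [X in _ + X](bigD1 (Ordinal lt_mn)) //= [X in _ + (_ + X)]big1; last first.
  by move=> p; rewrite -val_eqE /= => /negbTE->; rewrite mulr0 oppr0 mulr0.
have partial k : (k <= n)%N ->
    \sum_(p < k) (-1) ^+ p * 'C(n.-1, p)%:R * ((n - p.+1)%:R * a p.+1 + p%:R * a p) =
    - ((-1) ^+ k * k%:R * 'C(n.-1, k)%:R * a k).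
  elim: k => [|k IHk] lt_kn; first by rewrite big_ord0 mulr0 !mul0r oppr0.
  rewrite big_ord_recr /= IHk 1?ltnW // exprS.
  have -> : (-1 * (-1) ^+ k * k.+1%:R * 'C(n.-1, k.+1)%:R : R) =
      - (-1) ^+ k * ((n - k.+1)%:R * 'C(n.-1, k)%:R).
    rewrite -mulrA -natrM mul_bin_left -natrM mulN1r; congr (_ * _%:R).
    by congr (_ * _)%N; lia.
  by ring.
(* This removes the boundary term with [a n], which is not a constant of the mechanism. *)
have bin0n : 'C(n.-1, n) = 0%N by rewrite bin_small // ltn_predL (leq_ltn_trans _ lt_mn).
rewrite partial // bin0n eqxx /=; ring.
Qed.

(** Summation by parts; Pascal's rule merges the two coefficients of each [s k]. *)
Lemma alternating_difference (s : nat -> R) (q : nat) :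
  \sum_(p < q.+1) (-1) ^+ p * 'C(q, p)%:R * (s p.+1 - s p) =
  - \sum_(k < q.+2) (-1) ^+ k * 'C(q.+1, k)%:R * s k.
Proof.
have partial j : \sum_(p < j.+1) (-1) ^+ p * 'C(q, p)%:R * (s p.+1 - s p) =
    (-1) ^+ j * 'C(q, j)%:R * s j.+1 -
    \sum_(k < j.+1) (-1) ^+ k * 'C(q.+1, k)%:R * s k.
  elim: j => [|j IHj]; first by rewrite !big_ord_recr !big_ord0 /= !bin0; ring.
  by rewrite big_ord_recr IHj [in RHS]big_ord_recr /= binS natrD exprS; ring.
by rewrite partial [in RHS]big_ord_recr /= !binn exprS; ring.
Qed.

Lemma alternating_vertices a :
  \sum_(k < n.+1) (-1) ^+ k * 'C(n, k)%:R * vertex_surplus n m L U a k =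
  (-1) ^+ m * m%:R * 'C(n.-1, m)%:R * (U - L).
Proof.
have n_gt0 : (0 < n)%N by apply: leq_ltn_trans lt_mn.
have := alternating_difference (vertex_surplus n m L U a) n.-1.
rewrite prednK // => /(canLR (@opprK _)) <-.
rewrite -[_ * (U - L)]opprK -mulNr -(alternating_coef a) mulr_suml; congr (- _).
by apply: eq_bigr => p _; rewrite vertex_surplusS //; ring.
Qed.

(** Only the [k]-th term of the alternating sum survives, and the sum has the sign of [(-1) ^+ m].
    As the vertex value is nonpositive, [(-1) ^+ k] has the opposite sign. *)
Lemma single_vertex_odd a (k : nat) : L < U -> (k <= n)%N ->
  (forall j, (j <= n)%N -> j != k -> vertex_surplus n m L U a j = 0) ->
  vertex_surplus n m L U a k <= 0 -> odd (k + m).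
Proof.
move=> ltLU le_kn s0 sk_le0; have := alternating_vertices a.
have lt_kn : (k < n.+1)%N by [].
rewrite (bigD1 (Ordinal lt_kn)) //= big1 ?addr0 => [|j]; last first.
  by rewrite -val_eqE /= => ne_jk; rewrite s0 ?mulr0 // -ltnS.
rewrite oddD -[(-1) ^+ k]signr_odd -[(-1) ^+ m]signr_odd.
have pos : 0 < m%:R * 'C(n.-1, m)%:R * (U - L).
  rewrite !mulr_gt0 ?subr_gt0 ?ltr0n ?bin_gt0 // -ltnS prednK //.
  exact: leq_ltn_trans lt_mn.
have neg : 'C(n, k)%:R * vertex_surplus n m L U a k <= 0 by rewrite mulr_ge0_le0.
rewrite -!mulrA in pos neg *.
by case: (odd k) (odd m) => [] [] //= eq_s; exfalso; move: eq_s pos neg; lra.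
Qed.

(** * The recursion [coef n m a p = 0] and its solutions [beta] and [alpha] *)

Lemma betaS (p : nat) : (m < p)%N -> (p.+1 < n)%N ->
  (n - p.+1)%:R * beta R n m p.+1 = - (p%:R * beta R n m p).
Proof.
move=> lt_mp lt_pn; rewrite /beta.
have e1 : ('C(p, m.-1) * (p - m.-1) = p * 'C(p.-1, m.-1))%N.
  by rewrite mul_bin_down mulnC.
have e2 : ((n - p.+1) * 'C(n - m.+1, n - p.+1) = (p - m.-1) * 'C(n - m.+1, n - p.+2))%N.
  have -> : (n - p.+1 = (n - p.+2).+1)%N by lia.
  by rewrite mul_bin_left; congr (_ * _)%N; lia.
have -> : (p.+1 - m - 1 = (p - m - 1).+1)%N by lia.
have -> : (p.+1 - 1 = p)%N by lia.
have -> : (p - 1 = p.-1)%N by lia.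
have -> : (m - 1 = m.-1)%N by lia.
have -> : (n - m - 1 = n - m.+1)%N by lia.
have -> : (n - p.+1 - 1 = n - p.+2)%N by lia.
have -> : (n - p - 1 = n - p.+1)%N by lia.
have c1 : 'C(n - m.+1, n - p.+1)%:R != 0 :> R by rewrite pnatr_eq0 -lt0n bin_gt0; lia.
have c2 : 'C(n - m.+1, n - p.+2)%:R != 0 :> R by rewrite pnatr_eq0 -lt0n bin_gt0; lia.
have c3 : (p - m.-1)%:R != 0 :> R by rewrite pnatr_eq0; lia.
move/(congr1 (fun k => k%:R : R)): e1; rewrite !natrM => e1.
move/(congr1 (fun k => k%:R : R)): e2; rewrite !natrM => e2.
(* Besides the denominators, multiply by [p - m.-1], the factor through which [e1] and [e2] shift
   the binomials. *)
rewrite exprS; apply: (mulIf c1); apply: (mulIf c2); apply: (mulIf c3).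
rewrite [LHS](_ : _ = - (-1) ^+ (p - m - 1) *
  ((n - p.+1)%:R * 'C(n - m.+1, n - p.+1)%:R) * ('C(p, m.-1)%:R * (p - m.-1)%:R)); last by field.
by rewrite e1 e2; field.
Qed.

Lemma alphaS (p : nat) : (0 < p)%N -> (p < m)%N ->
  p%:R * alpha R n m p = - ((n - p.+1)%:R * alpha R n m p.+1).
Proof.
move=> p_gt0 lt_pm; rewrite /alpha.
have e1 : ((n - p.+1) * 'C(n - p.+2, n - m.+1) = (m - p) * 'C(n - p.+1, n - m.+1))%N.
  have -> : (n - p.+2 = (n - p.+1).-1)%N by lia.
  by rewrite mul_bin_down; congr (_ * _)%N; lia.
have e2 : (p * 'C(m.-1, p) = (m - p) * 'C(m.-1, p.-1))%N.
  by case: p p_gt0 {e1} lt_pm => // p _ lt_pm; rewrite mul_bin_left /=; congr (_ * _)%N; lia.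
have -> : (m - p = (m - p.+1).+1)%N by lia.
have -> : (p.+1 - 1 = p)%N by lia.
have -> : (p - 1 = p.-1)%N by lia.
have -> : (m - 1 = m.-1)%N by lia.
have -> : (n - m - 1 = n - m.+1)%N by lia.
have -> : (n - p.+1 - 1 = n - p.+2)%N by lia.
have -> : (n - p - 1 = n - p.+1)%N by lia.
have c1 : 'C(m.-1, p)%:R != 0 :> R by rewrite pnatr_eq0 -lt0n bin_gt0; lia.
have c2 : 'C(m.-1, p.-1)%:R != 0 :> R by rewrite pnatr_eq0 -lt0n bin_gt0; lia.
have c3 : (m - p)%:R != 0 :> R by rewrite pnatr_eq0; lia.
move/(congr1 (fun k => k%:R : R)): e1; rewrite !natrM => e1.
move/(congr1 (fun k => k%:R : R)): e2; rewrite !natrM => e2.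
rewrite exprS; apply: (mulIf c1); apply: (mulIf c2); apply: (mulIf c3).
rewrite [RHS](_ : _ = - (-1) ^+ (m - p.+1) * ((n - p.+1)%:R * 'C(n - p.+2, n - m.+1)%:R) *
  ((m - p)%:R * 'C(m.-1, p.-1)%:R)); last by field.
by rewrite e1 -e2; field.
Qed.

(** The starting value of the upward recursion: [coef n m a m = 0] with [a m = 0]. *)
Lemma beta_first : (m.+1 < n)%N -> (n - m.+1)%:R * beta R n m m.+1 = m%:R.
Proof.
move=> lt_m1n; rewrite /beta subSnn subnn expr0 mul1r subn1 /= subn1.
case: m m_gt0 lt_m1n => // k _ lt_kn /=.
rewrite binSn (_ : (n - k.+1 - 1 = (n - k.+2 - 1).+1)%N) ?binSn; last by lia.
rewrite (_ : (n - k.+2 = (n - k.+2 - 1).+1)%N); last by lia.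
by rewrite subSS subn0 mulrC divfK // pnatr_eq0.
Qed.

Lemma alpha_last : alpha R n m m = 1.
Proof. by rewrite /alpha subnn expr0 !binn mul1r divr1. Qed.

(** Upward induction. At [p = 0] the term [p%:R * a p] vanishes whatever [a 0] is, so zeros
    propagate until the source [m] at [p = m] starts [beta]. *)
Lemma coef_eq0_beta a (r : nat) : (r < n)%N ->
  (forall p, (p < r)%N -> coef n m a p = 0) ->
  forall j, (0 < j <= r)%N -> a j = if (m < j)%N then beta R n m j else 0.
Proof.
move=> lt_rn coef0; elim=> // p IHp lt_pr.
have nz : (n - p.+1)%:R != 0 :> R by rewrite pnatr_eq0; lia.
have pa : p%:R * a p = p%:R * (if (m < p)%N then beta R n m p else 0).
  by case: p IHp lt_pr {nz} => [|p] IHp lt_pr; rewrite ?mul0r // IHp //; lia.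
have := coef0 p lt_pr; rewrite /coef pa => rec; apply: (mulfI nz).
case: (ltngtP m p) rec => [lt_mp | lt_pm | eq_mp].
- rewrite ltnS (ltnW lt_mp) betaS //; last by lia.
  by rewrite /= mulr0; lra.
- rewrite ltnS leqNgt lt_pm /= !mulr0; lra.
- rewrite -eq_mp ltnS leqnn /= beta_first; last by lia.
  by rewrite mulr0 mulr1; lra.
Qed.

(** Downward induction from [p = n - 1], where [a n] has weight 0; zeros propagate down to the
    source at [p = m], which gives [a m = 1] and starts [alpha]. *)
Lemma coef_eq0_alpha a (r : nat) : (0 < r)%N ->
  (forall p, (r <= p < n)%N -> coef n m a p = 0) ->
  forall j, (r <= j < n)%N -> a j = if (j <= m)%N then alpha R n m j else 0.
Proof.
move=> r_gt0 coef0 j; have [d] := ubnP (n - j); elim: d j => // d IHd p le_d /andP[le_rp lt_pn].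
have nz : p%:R != 0 :> R by rewrite pnatr_eq0; lia.
have pa : (n - p.+1)%:R * a p.+1 =
    (n - p.+1)%:R * (if (p.+1 <= m)%N then alpha R n m p.+1 else 0).
  have [eq_pn | ne_pn] := eqVneq p.+1 n; first by rewrite eq_pn subnn !mul0r.
  by rewrite IHd //; lia.
have := coef0 p; rewrite le_rp lt_pn /coef pa => /(_ isT) rec; apply: (mulfI nz).
case: (ltngtP p m) rec => [lt_pm | lt_mp | ->].
- rewrite alphaS //=; last by lia.
  by rewrite mulr0; lra.
- by rewrite /= !mulr0; lra.
- by rewrite alpha_last /= mulr0 mulr1; lra.
Qed.

(** Consecutive vertex values vanish away from [k], so [coef] vanishes except possibly at [k - 1]
    and [k]: the upward solution holds below [k], the downward one above. The constant profiles then
    fix [a k] and [a 0]. *)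
Lemma single_vertex_oel a (k : nat) : L < U -> (k <= n)%N -> odd (k + m) ->
  (forall j, (j <= n)%N -> j != k -> vertex_surplus n m L U a j = 0) ->
  forall j, (j < n)%N -> a j = oel_coef n m L U k j.
Proof.
move=> ltLU le_kn odd_km s0.
have n_gt0 : (0 < n)%N by apply: leq_ltn_trans lt_mn.
have nR : n%:R != 0 :> R by rewrite pnatr_eq0 -lt0n.
have ne_km : k != m.
  by apply/eqP => eq_km; move: odd_km; rewrite eq_km addnn odd_double.
have coef0 p : (p < n)%N -> p != k -> p.+1 != k -> coef n m a p = 0.
  move=> lt_pn ne_pk ne_p1k; apply: (@mulfI _ (U - L)); first by rewrite subr_eq0 gt_eqF.
  by rewrite -vertex_surplusS // !s0 ?subr0 ?mulr0 // ltnW.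
have lo j : (0 < j < k)%N -> a j = if (m < j)%N then beta R n m j else 0.
  move=> /andP[j_gt0 lt_jk]; apply: (@coef_eq0_beta a k.-1); [lia| |lia].
  by move=> p lt_pk; apply: coef0; lia.
have hi j : (k < j < n)%N -> a j = if (j <= m)%N then alpha R n m j else 0.
  move=> lt_kjn; apply: (@coef_eq0_alpha a k.+1) => // p /andP[lt_kp lt_pn].
  by apply: coef0; lia.
have sum0 (F : nat -> R) (i j : nat) :
    (forall l, (i <= l < j)%N -> F l = 0) -> \sum_(i <= l < j) F l = 0.
  by move=> F0; rewrite big_nat big1.
have bottom : k != 0%N -> n%:R * a 0%N + L * (n%:R * \sum_(1 <= j < n) a j - m%:R) = 0.
  by move=> nz_k; rewrite -vertex_surplus0 s0 // eq_sym.
have top : k != n -> n%:R * a 0%N + U * (n%:R * \sum_(1 <= j < n) a j - m%:R) = 0.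
  by move=> ne_kn; rewrite -vertex_surplusn s0 // eq_sym.
(* An affine function vanishing at both [L] and [U] has zero slope and zero intercept. *)
have balanced : k != 0%N -> k != n ->
    a 0%N = 0 /\ \sum_(1 <= j < n) a j = m%:R / n%:R.
  move=> nz_k ne_kn; have eqL := bottom nz_k; have eqU := top ne_kn.
  set S := \sum_(1 <= j < n) a j in eqL eqU *.
  have T0 : n%:R * S - m%:R = 0.
    apply: (@mulfI _ (U - L)); first by rewrite subr_eq0 gt_eqF.
    by rewrite mulr0; lra.
  split; first by apply: (mulfI nR); rewrite mulr0; move: eqL; rewrite T0 mulr0 addr0.
  by apply: (mulfI nR); rewrite mulrCA divff // mulr1; lra.
move=> j lt_jn; rewrite /oel_coef.
(* For [k = 0] every [a j] with [j > 0] follows the downward solution, and the vanishing at the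
   all-[U] profile gives [a 0]. *)
have [k0 | nz_k] := eqVneq k 0%N.
  rewrite {}k0 in hi top *; have eqU := top _; clear bottom balanced lo.
  case: j lt_jn => [_ | j lt_jn] /=; last by apply: hi.
  have Ssum : \sum_(1 <= j < n) a j = \sum_(1 <= j < m.+1) alpha R n m j.
    rewrite (@big_cat_nat _ _ _ m.+1) //= [X in _ + X]sum0 ?addr0.
      by apply: eq_big_nat => j lt_jm; rewrite hi ?ifT //; lia.
    by move=> j lt_jm; rewrite hi ?ifF //; lia.
  have {}eqU : n%:R * a 0%N = U * (m%:R - n%:R * \sum_(1 <= j < m.+1) alpha R n m j).
    by rewrite -Ssum; have := eqU (negbT (ltn_eqF n_gt0)); lra.
  by apply: (mulfI nR); rewrite eqU; field.
have [le_km | lt_mk] := leqP k m.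
  have [a0 Ssum] : a 0%N = 0 /\ \sum_(1 <= j < n) a j = m%:R / n%:R.
    by apply: balanced => //; lia.
  case: (ltngtP j k) => [lt_jk | lt_kj | ->] /=; last first.
  - rewrite -Ssum (@big_cat_nat _ _ _ k) //=; [|lia..].
    rewrite (@big_ltn _ _ _ k n) /=; last by lia.
    rewrite (@big_cat_nat _ _ _ m.+1 k.+1 n) //=; [|lia..].
    rewrite [X in _ = X + _ - _]sum0; last by move=> l l_lt; rewrite lo ?ifF //; lia.
    rewrite [X in _ = _ + (_ + (_ + X)) - _]sum0; last first.
      by move=> l l_lt; rewrite hi ?ifF //; lia.
    rewrite (@eq_big_nat _ _ _ _ _ a (alpha R n m)).
      by rewrite add0r addr0 addrK.
    by move=> l l_lt; rewrite hi ?ifT //; lia.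
  - by rewrite hi //; lia.
  - case: j lt_jk {lt_jn} => // j lt_jk; rewrite lo ?ifF //; lia.
have [lt_kn | ge_kn] := ltnP k n.
  have [a0 Ssum] : a 0%N = 0 /\ \sum_(1 <= j < n) a j = m%:R / n%:R.
    by apply: balanced => //; lia.
  case: (ltngtP j k) => [lt_jk | lt_kj | ->] /=; last first.
  - rewrite -Ssum (@big_cat_nat _ _ _ k) //=; [|lia..].
    rewrite (@big_ltn _ _ _ k n) /=; last by lia.
    rewrite (@big_cat_nat _ _ _ m.+1 1 k) //=.
    rewrite [X in _ = X + _ + _ - _]sum0; last by move=> l l_lt; rewrite lo ?ifF //; lia.
    rewrite [X in _ = _ + (_ + X) - _]sum0; last first.
      by move=> l l_lt; rewrite hi ?ifF //; lia.
    rewrite (@eq_big_nat _ _ _ _ _ a (beta R n m)).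
      by rewrite add0r addr0 addrAC subrr add0r.
    by move=> l l_lt; rewrite lo ?ifT //; lia.
  - by rewrite andbF hi ?ifF //; lia.
  - by case: j lt_jk {lt_jn} => // j lt_jk; rewrite andbT lo //; lia.
(* For [k = n] the upward solution covers all positive indices, and the all-[L] profile gives
   [a 0]. *)
have eq_kn : k = n by lia.
clear balanced top hi; subst k; have eqL := bottom nz_k.
case: j lt_jn => [_ | j lt_jn] /=; last by rewrite lt_jn andbT lo.
have Ssum : \sum_(1 <= j < n) a j = \sum_(m.+1 <= j < n) beta R n m j.
  rewrite (@big_cat_nat _ _ _ m.+1) //= [X in X + _]sum0 ?add0r.
    by apply: eq_big_nat => j lt_jm; rewrite lo ?ifT //; lia.
  by move=> j lt_jm; rewrite lo ?ifF //; lia.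
have {}eqL : n%:R * a 0%N = L * (m%:R - n%:R * \sum_(m.+1 <= j < n) beta R n m j).
  by rewrite -Ssum; lra.
by apply: (mulfI nR); rewrite eqL; field.
Qed.

End Coefficients.

Theorem theorem2 (R : realFieldType) (n m : nat) (L U : R)
  (hn : (2 <= n)%N) (hm1 : (1 <= m)%N) (hmn : (m <= n - 1)%N) (hLU : L < U)
  (a : nat -> R) :
  @feasible R n L U (@anon_lin R n m a) ->
  @undominated R n m L U (@anon_lin R n m a) ->
  @is_OEL R n m L U (@anon_lin R n m a).
Proof.
move=> feas undom; have lt_mn : (m < n)%N by lia.
pose s := vertex_surplus n m L U a.
have [k le_kn s0] : exists2 k, (k <= n)%N & forall j, (j <= n)%N -> j != k -> s j = 0.
  have [k nz_k | s_eq0] := pickP (fun k : 'I_n.+1 => s k != 0); last first.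
    (* If all values vanish, any index serves here; the alternating sum shows that this case is in
       fact contradictory. *)
    by exists 0%N => // j le_jn _; apply/eqP/negbFE/(s_eq0 (Ordinal (le_jn : (j < n.+1)%N))).
  exists k => [|j le_jn ne_jk]; first by rewrite -ltnS.
  apply/eqP; case: (ltngtP j k) ne_jk => // [lt_jk | lt_kj] _.
    have := @vertex_surplus_unique R n m L U a j k lt_mn hLU feas undom.
    by rewrite lt_jk -ltnS ltn_ord (negbTE nz_k) orbF; apply.
  have := @vertex_surplus_unique R n m L U a k j lt_mn hLU feas undom.
  by rewrite lt_kj le_jn (negbTE nz_k); apply.
have odd_km : odd (k + m).
  exact: single_vertex_odd hLU le_kn s0 (vertex_surplus_le0 k lt_mn (ltW hLU) feas).
have aE := single_vertex_oel hm1 lt_mn hLU le_kn odd_km s0.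
exists k; split=> //; split=> // i theta _; rewrite /anon_lin aE //; last by lia.
by congr (_ + _); apply: eq_big_nat => j /andP[_ lt_jn]; rewrite aE.
Qed.
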